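(* Let $K$ be an arbitrary field of characteristic $0$ such that the equation $\lambda^2+\lambda+1=0$ has a solution $\epsilon$ in $K$, and let $\alpha\in K$. If $\alpha^3\neq 1$, then the group $\mathrm{Aut}\,E_\alpha$ of automorphisms of the elliptic Poisson algebra $E_\alpha$ is generated by the automorphisms $\varphi_\gamma$ ($\gamma\in K^*$), $\sigma$ and $\tau$.
   Context: For $\alpha\in K$ put $C=\frac13(x^3+y^3+z^3)-\alpha xyz\in K[x,y,z]$. The elliptic Poisson algebra $E_\alpha$ is the polynomial algebra $K[x,y,z]$ endowed with the Poisson bracket determined by $\{x,y\}=-\alpha xy+z^2$, $\{y,z\}=-\alpha yz+x^2$, $\{z,x\}=-\alpha zx+y^2$; equivalently $\{u,v\}=J(u,v,C)$ for all $u,v\in K[x,y,z]$, where $J(f_1,f_2,f_3)$ is the determinant of the Jacobian matrix of $(f_1,f_2,f_3)$ with respect to $(x,y,z)$. An automorphism of a Poisson algebra $P$ over $K$ is a bijective $K$-linear map $\phi:P\to P$ with $\phi(ab)=\phi(a)\phi(b)$ and $\phi(\{a,b\})=\{\phi(a),\phi(b)\}$ for all $a,b\in P$. $\mathrm{Aut}\,E_\alpha$ is the group of automorphisms of $E_\alpha$ as a Poisson algebra. $K^*$ is the multiplicative group of $K$. The following are automorphisms of $E_\alpha$: $\varphi_\gamma$ ($\gamma\in K^*$), given by $x\mapsto\gamma x$, $y\mapsto\gamma y$, $z\mapsto\gamma z$; $\tau$, given by $x\mapsto y$, $y\mapsto z$, $z\mapsto x$; and $\sigma$, given by $x\mapsto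 x$, $y\mapsto\epsilon y$, $z\mapsto\epsilon^2 z$. *)

(* Defs.v *)
From mathcomp Require Import all_boot all_order all_algebra.
From mathcomp.multinomials Require Export mpoly.
From mathcomp Require Import ring.

Set Implicit Arguments.
Unset Strict Implicit.
Unset Printing Implicit Defensive.

Import GRing.Theory.
Local Open Scope ring_scope.

Section EllipticPoisson.
Variable K : fieldType.

Notation P := {mpoly K[3]}.

(* The indices 0, 1, 2 below are elements of the ring 'I_3. *)
Definition varx : P := 'X_0.
Definition vary : P := 'X_1.
Definition varz : P := 'X_2.

Definition jacobian (f1 f2 f3 : P) : P :=
  \det (\matrix_(i < 3, j < 3) ([:: f1; f2; f3]`_i)^`M(j)).

Definition casimir (alpha : K) : P :=
  3%:R^-1 *: (varx ^+ 3 + vary ^+ 3 + varz ^+ 3)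
  - alpha *: (varx * vary * varz).

Definition elliptic_bracket (alpha : K) (u v : P) : P :=
  jacobian u v (casimir alpha).

(* Preservation of the unit is not required: it follows from surjectivity. *)
Definition poisson_aut (bracket : P -> P -> P) (phi : P -> P) : Prop :=
  [/\ bijective phi, linear phi,
      {morph phi : a b / a * b}
    & {morph phi : a b / bracket a b}].

Definition phi_scale (gamma : K) (p : P) : P :=
  p \mPo [tuple gamma *: varx; gamma *: vary; gamma *: varz].

Definition sigma (eps : K) (p : P) : P :=
  p \mPo [tuple varx; eps *: vary; eps ^+ 2 *: varz].

Definition tau (p : P) : P := p \mPo [tuple vary; varz; varx].

Inductive elliptic_gens (eps : K) : (P -> P) -> Prop :=
| Gen_phi gamma of gamma != 0 : elliptic_gens eps (phi_scale gamma)
| Gen_sigma : elliptic_gens eps (sigma eps)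
| Gen_tau : elliptic_gens eps tau.

End EllipticPoisson.

Arguments varx {K}.
Arguments vary {K}.
Arguments varz {K}.
Arguments tau {K} p.

(* The subgroup generated by a set [S] of bijections of [T], with composition  *)
(* as group law. As [g] ranges over all functions inverse to [f], this set is  *)
(* closed under pointwise equality without assuming extensionality.            *)
Inductive generated (T : Type) (S : (T -> T) -> Prop) : (T -> T) -> Prop :=
| Generated_gen f of S f : generated S f
| Generated_id : generated S id
| Generated_comp f g of generated S f & generated S g : generated S (f \o g)
| Generated_inv f g of generated S f & cancel f g & cancel g f :
    generated S g.

Section Facts.
Variable K : fieldType.
Notation P := {mpoly K[3]}.
Implicit Types (bracket : P -> P -> P) (f g : P -> P).

Lemma poisson_aut_id bracket : poisson_aut bracket id.
Proof. by split=> //; exists id. Qed.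

Lemma poisson_aut_comp bracket f g :
  poisson_aut bracket f -> poisson_aut bracket g ->
  poisson_aut bracket (f \o g).
Proof.
move=> [bf lf mf pf] [bg lg mg pg]; split; first exact: bij_comp.
- by move=> a p q /=; rewrite lg lf.
- by move=> p q /=; rewrite mg mf.
- by move=> p q /=; rewrite pg pf.
Qed.

Lemma poisson_aut_inv bracket f g :
  poisson_aut bracket f -> cancel f g -> cancel g f -> poisson_aut bracket g.
Proof.
move=> [bf lf mf pf] fK gK; split; first by exists f.
- by move=> a p q /=; apply: (can_inj fK); rewrite lf !gK.
- by move=> p q /=; apply: (can_inj fK); rewrite mf !gK.
- by move=> p q /=; apply: (can_inj fK); rewrite pf !gK.
Qed.

Lemma det_mx33 (R : comNzRingType) (A : 'M[R]_3) :
  \det A = A 0 0 * (A 1 1 * A 2 2 - A 1 2 * A 2 1)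
    - A 0 1 * (A 1 0 * A 2 2 - A 1 2 * A 2 0)
    + A 0 2 * (A 1 0 * A 2 1 - A 1 1 * A 2 0).
Proof.
pose a (i j : nat) := A (inord i) (inord j).
have aE (i j : 'I_3) : A i j = a i j by rewrite /a !inord_val.
rewrite (expand_det_row A 0) !big_ord_recl big_ord0 /cofactor.
rewrite !(expand_det_row _ 0) !big_ord_recl !big_ord0 /cofactor !det_mx11.
rewrite !mxE !aE /= /bump /=.
ring.
Qed.

Lemma jacobianE (u v w : P) :
  jacobian u v w =
    u^`M(0) * (v^`M(1) * w^`M(2) - v^`M(2) * w^`M(1))
  - u^`M(1) * (v^`M(0) * w^`M(2) - v^`M(2) * w^`M(0))
  + u^`M(2) * (v^`M(0) * w^`M(1) - v^`M(1) * w^`M(0)).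
Proof. by rewrite /jacobian det_mx33 !mxE. Qed.

Lemma elliptic_bracket_xyz (alpha : K) : [pchar K] =i pred0 ->
  [/\ elliptic_bracket alpha varx vary = - alpha *: (varx * vary) + varz ^+ 2,
      elliptic_bracket alpha vary varz = - alpha *: (vary * varz) + varx ^+ 2
    & elliptic_bracket alpha varz varx = - alpha *: (varz * varx) + vary ^+ 2].
Proof.
move=> charK.
have n3 : 3%:R != 0 :> K by rewrite ((pcharf0P K).1 charK).
have dX (i j : 'I_3) : ('X_i : P)^`M(j) = (i == j)%:R.
  rewrite mderivX mnm1E; case: eqP => [->|_]; last by rewrite scale0r.
  by rewrite -{1}(add0m U_(j)%MM) addmK scale1r mpolyX0.
have dC (i : 'I_3) : (casimir alpha)^`M(i) =
    'X_i ^+ 2 - alpha *: ((i == 0)%:R * (vary * varz)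
      + (i == 1)%:R * (varx * varz) + (i == 2)%:R * (varx * vary)).
  have dX3 (j : 'I_3) :
      ('X_j ^+ 3 : P)^`M(i) = 3%:R *: ((j == i)%:R * 'X_j ^+ 2).
    by rewrite !exprS expr0 mulr1 !mderivM !dX scaler_nat; ring.
  rewrite /casimir /varx /vary /varz mderivB !mderivZ !mderivD !dX3 !mderivM.
  rewrite !dX -!scalerDr scalerA mulVf // scale1r ![i == _]eq_sym.
  congr (_ - _ *: _); last by ring.
  case: i {dX3} => [[|[|[|//]]] ?]; rewrite !(mul1r, mul0r, addr0, add0r);
    by congr ('X_ _ ^+ 2); apply: val_inj.
rewrite /elliptic_bracket !jacobianE !dC !dX !eqxx -!mul_mpolyC mpolyCN.
rewrite /varx /vary /varz /=.
by split; ring.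
Qed.
End Facts.

(* Main.v *)
From HB Require Import structures.
Require Import Defs.
From mathcomp Require Import all_boot all_order all_algebra.
From mathcomp Require Import ring zify.

Set Implicit Arguments.
Unset Strict Implicit.
Unset Printing Implicit Defensive.

Import GRing.Theory.
Local Open Scope ring_scope.

(** Let F = (f, g, h) be the images of x, y, z under an automorphism phi, and
    let N be the gradient of the casimir C, so that phi is Poisson exactly when
    the brackets of f, g, h are the components of N(F) ([poisson_triple]).
    The condition alpha^3 <> 1 says that the projective cubic C = 0 is smooth,
    that is, that N vanishes only at the origin; [qgrad_elim] is an explicit
    certificate for this.

    The heart of the proof is that F is linear. The chain rule shows that the
    Jacobian determinant of F is a unit, hence a constant. Suppose that F has
    degree n >= 2, and let T be its form of degree n. As the bracket is
    homogeneous, T is again a Poisson triple, and its Jacobian determinant is 0,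
    being the part of positive degree 3n - 3 of a constant. Cramer's rule and
    Euler's identity then give C(T) = 0: T would parametrize a smooth plane
    cubic by polynomials. Since such a curve has no rational parametrization,
    the components of T are proportional ([wronskian_eq0] in one variable,
    [mderiv_wronskian_eq0] along each coordinate direction). Then their brackets
    vanish, so N(T) = 0 and T = 0, a contradiction.

    The constant part of F is a zero of N, hence is 0. It remains to find the
    matrices A with C(AX) = det(A) C(X), written out through the gradient of C.
    Comparing coefficients gives nine binomial equations between the entries;
    smoothness forces at least one factor of certain products to vanish, and
    the possible patterns of zeros are then exactly those of permutation
    matrices ([monomial_of_rel]). The remaining equations exclude the odd
    permutations and say that the three entries are a, ta, t^2 a with t^3 = 1
    ([linear_triple], [diag_generated]), so that phi is a composition of a
    homothety with powers of sigma and tau. *)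

(** * The gradient of the cubic *)

(** The gradient of [x^3/3 + y^3/3 + z^3/3 - a x y z] at [(x, y, z)] is
    [(qgrad a x y z, qgrad a y z x, qgrad a z x y)]: one function serves for the
    three partial derivatives, because the cubic is invariant under cyclic
    permutations. *)
Definition qgrad (R : comNzRingType) (a x y z : R) : R := x ^+ 2 - a * (y * z).

Lemma qgrad_euler (R : comNzRingType) (a x y z : R) :
  x * qgrad a x y z + y * qgrad a y z x + z * qgrad a z x y =
    x ^+ 3 + y ^+ 3 + z ^+ 3 - 3%:R * a * (x * y * z).
Proof. by rewrite /qgrad; ring. Qed.

(** The fourth powers of the variables lie in the ideal of the partial
    derivatives when [a ^+ 3 != 1]. The same identity shows that the gradient
    has no zero, that it has no common factor on coprime polynomials, and that
    its degree does not drop. *)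
Lemma qgrad_elim (R : comNzRingType) (a x y z : R) :
  (1 - a ^+ 3) * x ^+ 4 =
    (x ^+ 2 * (1 - a ^+ 3) + a * (y * z)) * qgrad a x y z
    + a ^+ 2 * z ^+ 2 * qgrad a y z x + a ^+ 3 * (x * z) * qgrad a z x y.
Proof. by rewrite /qgrad; ring. Qed.

Lemma qgrad_eq0 (R : idomainType) (a x y z : R) : a ^+ 3 != 1 ->
    qgrad a x y z = 0 -> qgrad a y z x = 0 -> qgrad a z x y = 0 ->
  [/\ x = 0, y = 0 & z = 0].
Proof.
rewrite -subr_eq0 -oppr_eq0 opprB => a3.
have vanish (u v w : R) :
    qgrad a u v w = 0 -> qgrad a v w u = 0 -> qgrad a w u v = 0 -> u = 0.
  move=> e1 e2 e3; have := qgrad_elim a u v w; rewrite e1 e2 e3 !mulr0 !addr0.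
  by move/eqP; rewrite mulf_eq0 (negPf a3) expf_eq0 => /eqP.
by move=> e1 e2 e3; split; [apply: (@vanish x y z) | apply: (@vanish y z x)
  | apply: (@vanish z x y)].
Qed.

(** * Polynomial parametrizations of a smooth cubic *)

Section OneVariable.
Variables (L : fieldType) (a : L).
Implicit Types (d f g h : {poly L}).
Notation q := (qgrad a%:P).

Lemma dvdp_expD d f g m n :
  d %| f ^+ m -> d %| g ^+ n -> d %| (f + g) ^+ (m + n).
Proof.
move=> df dg; rewrite exprDn; apply: (big_ind (fun r => d %| r)) => [|x y|i _].
- exact: dvdp0.
- exact: dvdp_add.
rewrite -mulr_natl dvdp_mull //; case: (leqP n i) => [ni | i_lt].
  by rewrite dvdp_mull // -(subnK ni) exprD dvdp_mull.
have -> : (m + n - i = (n - i) + m)%N by lia.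
by rewrite dvdp_mulr // exprD dvdp_mull.
Qed.

Lemma bezout3 f g h :
  exists u v w, [/\ u * f + v * g + w * h %| f, u * f + v * g + w * h %| g
    & u * f + v * g + w * h %| h].
Proof.
have [[u v] /= uv] := Bezoutp f g; set k := u * f + v * g in uv *.
have [[s w] /= sw] := Bezoutp k h.
exists (s * u), (s * v), w.
have -> : s * u * f + s * v * g + w * h = s * k + w * h by rewrite /k; ring.
rewrite !(eqp_dvdl _ sw) dvdp_gcdr.
have dk : gcdp k h %| gcdp f g by rewrite -(eqp_dvdr _ uv) dvdp_gcdl.
by split=> //; apply: dvdp_trans dk _; rewrite (dvdp_gcdl, dvdp_gcdr).
Qed.

Hypothesis a3 : a ^+ 3 != 1.

Lemma dvdp_qgrad d f g h :
  d %| q f g h -> d %| q g h f -> d %| q h f g -> d %| f ^+ 4.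
Proof.
move=> d1 d2 d3; have c1 : 1 - a ^+ 3 != 0 by rewrite subr_eq0 eq_sym.
rewrite -(@dvdpZr _ (1 - a ^+ 3)) // -mul_polyC.
have -> : (1 - a ^+ 3)%:P = 1 - a%:P ^+ 3 by rewrite polyCB polyC_exp.
by rewrite (qgrad_elim _ f g h) !dvdp_add // dvdp_mull.
Qed.

(** The leading coefficients of [f, g, h] in degree [n.-1] form a nonzero vector,
    whose gradient is nonzero by smoothness, so the gradient of [(f, g, h)] has
    degree exactly [2 * n.-1]. The argument through [qgrad_elim] avoids leading
    coefficients: if all three components had lower degree, [f ^+ 4] could not
    have degree [4 * n.-1]. *)
Lemma size_qgrad f g h n : (0 < n)%N ->
    (size g <= n)%N -> (size h <= n)%N -> size f = n ->
  ~~ [&& (size (q f g h) < n.*2.-1)%N, (size (q g h f) < n.*2.-1)%N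
       & (size (q h f g) < n.*2.-1)%N].
Proof.
move=> n0 gn hn fn; apply/negP => /and3P[s1 s2 s3].
have c1 : 1 - a ^+ 3 != 0 by rewrite subr_eq0 eq_sym.
have f0 : f != 0 by rewrite -size_poly_gt0 fn.
have sf4 : size ((1 - a ^+ 3)%:P * f ^+ 4) = (n.-1 * 4).+1.
  by rewrite mul_polyC size_scale // -fn -size_exp prednK ?size_poly_gt0 ?expf_neq0.
have szM (u v : {poly L}) i j : (size u <= i.+1)%N -> (size v <= j.+1)%N ->
    (size (u * v)%R <= (i + j).+1)%N.
  by move=> ui vj; apply: leq_trans (size_polyMleq _ _) _; lia.
have szC (c : L) : (size c%:P <= 1)%N by exact: size_polyC_leq1.
have bound (u v : {poly L}) : (size u <= n.-1.*2.+1)%N ->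
    (size v < n.*2.-1)%N -> (size (u * v)%R <= n.-1 * 4)%N.
  by move=> un vn; apply: leq_trans (size_polyMleq _ _) _; lia.
suff : (size ((1 - a ^+ 3)%:P * f ^+ 4)%R <= n.-1 * 4)%N by rewrite sf4 ltnn.
have sq (u v : {poly L}) : (size u <= n)%N -> (size v <= n)%N ->
    (size (u * v)%R <= n.-1.*2.+1)%N.
  by move=> un vn; rewrite -addnn; apply: szM; rewrite prednK.
have fn' : (size f <= n)%N by rewrite fn.
have scl (c : L) (u : {poly L}) : (size u <= n.-1.*2.+1)%N ->
    (size (c%:P * u)%R <= n.-1.*2.+1)%N.
  by move=> un; rewrite -[n.-1.*2]add0n; apply: szM.
have -> : (1 - a ^+ 3)%:P = 1 - a%:P ^+ 3 by rewrite polyCB polyC_exp.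
rewrite (qgrad_elim _ f g h).
have szD (u v : {poly L}) k : (size u <= k)%N -> (size v <= k)%N ->
    (size (u + v)%R <= k)%N.
  by move=> uk vk; apply: leq_trans (size_polyD _ _) _; rewrite geq_max uk.
apply: (szD); first apply: (szD); apply: bound => //.
- have -> : f ^+ 2 * (1 - a%:P ^+ 3) + a%:P * (g * h) =
      (1 - a ^+ 3)%:P * (f * f) + a%:P * (g * h).
    by rewrite polyCB polyC_exp; ring.
  by rewrite szD // scl // sq.
- by rewrite -polyC_exp expr2 scl ?sq.
- by rewrite -polyC_exp scl ?sq.
Qed.

(** A smooth cubic has no nonconstant polynomial parametrization. Both the point
    [F = (f, g, h)] and its derivative are orthogonal to the gradient [N], so
    [N] and the cross product [M] of [F] and its derivative are parallel. As the
    components of [N] have no common factor, [M = r N] for a polynomial [r]. If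
    [F] has degree [n], then [N] has degree [2n] while [M] has degree at most
    [2n - 1], so [r = 0]. *)
Lemma wronskian_of_coprime f g h : 3%:R != 0 :> L ->
    (exists u v w, u * f + v * g + w * h = 1) ->
    f ^+ 3 + g ^+ 3 + h ^+ 3 = 3%:R * a%:P * (f * g * h) ->
  [/\ f * g^`() = g * f^`(), g * h^`() = h * g^`() & h * f^`() = f * h^`()].
Proof.
move=> n3 [u [v [w cop]]] C0.
pose N1 := q f g h; pose N2 := q g h f; pose N3 := q h f g.
pose M1 := g * h^`() - h * g^`().
pose M2 := h * f^`() - f * h^`().
pose M3 := f * g^`() - g * f^`().
have NF : f * N1 + g * N2 + h * N3 = 0.
  by rewrite qgrad_euler C0 subrr.
have NF' : f^`() * N1 + g^`() * N2 + h^`() * N3 = 0.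
  have n3P : 3%:R != 0 :> {poly L} by rewrite -polyC_natr polyC_eq0.
  have := congr1 (@deriv L) NF; rewrite /N1 /N2 /N3 /qgrad linear0 !expr2.
  rewrite !(derivD, derivN, derivM, derivC) => dC.
  apply: (mulfI n3P); rewrite mulr0 -dC; ring.
(* M and N are parallel: N x (F x F') = F (N.F') - F' (N.F) = 0. *)
have M12 : M1 * N2 = M2 * N1.
  apply/eqP; rewrite -subr_eq0; apply/eqP.
  transitivity (h^`() * (f * N1 + g * N2 + h * N3)
    - h * (f^`() * N1 + g^`() * N2 + h^`() * N3)); first by rewrite /M1 /M2; ring.
  by rewrite NF NF' !mulr0 subrr.
have M23 : M2 * N3 = M3 * N2.
  apply/eqP; rewrite -subr_eq0; apply/eqP.
  transitivity (f^`() * (f * N1 + g * N2 + h * N3)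
    - f * (f^`() * N1 + g^`() * N2 + h^`() * N3)); first by rewrite /M2 /M3; ring.
  by rewrite NF NF' !mulr0 subrr.
have M31 : M3 * N1 = M1 * N3.
  apply/eqP; rewrite -subr_eq0; apply/eqP.
  transitivity (g^`() * (f * N1 + g * N2 + h * N3)
    - g * (f^`() * N1 + g^`() * N2 + h^`() * N3)); first by rewrite /M3 /M1; ring.
  by rewrite NF NF' !mulr0 subrr.
have [u' [v' [w' [d1 d2 d3]]]] := bezout3 N1 N2 N3.
set d := _ + _ in d1 d2 d3.
(* Smoothness: a common factor of N divides the fourth powers of f, g, h. *)
have d_unit : size d = 1.
  have df := dvdp_qgrad d1 d2 d3.
  have dg := dvdp_qgrad d2 d3 d1.
  have dh := dvdp_qgrad d3 d1 d2.
  have mulX4 s t : d %| t ^+ 4 -> d %| (s * t) ^+ 4.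
    by move=> dt; rewrite exprMn dvdp_mull.
  have := dvdp_expD (dvdp_expD (mulX4 u _ df) (mulX4 v _ dg)) (mulX4 w _ dh).
  by rewrite cop expr1n dvdp1 => /eqP.
have d0 : d != 0 by rewrite -size_poly_gt0 d_unit.
pose r := u' * M1 + v' * M2 + w' * M3.
have e1 : d * M1 = r * N1.
  rewrite /d /r; transitivity (u' * M1 * N1 + v' * (M1 * N2) + w' * (M1 * N3)).
    by ring.
  by rewrite M12 -M31; ring.
have e2 : d * M2 = r * N2.
  rewrite /d /r; transitivity (u' * (M2 * N1) + v' * M2 * N2 + w' * (M2 * N3)).
    by ring.
  by rewrite -M12 M23; ring.
have e3 : d * M3 = r * N3.
  rewrite /d /r; transitivity (u' * (M3 * N1) + v' * (M3 * N2) + w' * M3 * N3).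
    by ring.
  by rewrite M31 -M23; ring.
have r0 : r = 0.
  apply/eqP; apply: contraT => r0.
  pose n := maxn (size f) (maxn (size g) (size h)).
  have [fn gn hn] : [/\ (size f <= n)%N, (size g <= n)%N & (size h <= n)%N].
    by rewrite /n; split; lia.
  have n0 : (0 < n)%N.
    rewrite lt0n; apply/eqP => n0; have := oner_neq0 {poly L}.
    rewrite -cop; move: fn gn hn; rewrite n0 !size_poly_leq0.
    by move=> /eqP-> /eqP-> /eqP->; rewrite !mulr0 !addr0 eqxx.
  have szM (s t : {poly L}) : (size s <= n)%N -> (size t <= n)%N ->
      (size (s * t^`())%R < n.*2.-1)%N.
    move=> sn tn; have [->|t0] := eqVneq t 0.
      by rewrite linear0 mulr0 size_poly0; lia.
    have := size_polyMleq s t^`(); have := lt_size_deriv t0; lia.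
  have szB (s t : {poly L}) : (size s <= n)%N -> (size t <= n)%N ->
      (size (s * t^`() - t * s^`())%R < n.*2.-1)%N.
    by move=> sn tn; rewrite (leq_ltn_trans (size_polyD _ _)) //
      size_polyN gtn_max !szM.
  have szN (M N : {poly L}) : d * M = r * N -> (size M < n.*2.-1)%N ->
      (size N < n.*2.-1)%N.
    move=> e Mn; have [->|N0] := eqVneq N 0; first by rewrite size_poly0; lia.
    apply: leq_ltn_trans Mn.
    have: (size (r * N)%R <= size M)%N.
      by rewrite -e; have := size_polyMleq d M; rewrite d_unit.
    apply: leq_trans; rewrite size_mul //.
    by rewrite -(prednK (n := size r)) ?size_poly_gt0 ?leq_addl.
  have s1 := szN _ _ e1 (szB _ _ gn hn).
  have s2 := szN _ _ e2 (szB _ _ hn fn).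
  have s3 := szN _ _ e3 (szB _ _ fn gn).
  have [/esym sz|[/esym sz|/esym sz]] : n = size f \/ n = size g \/ n = size h.
    by rewrite /n; lia.
  - by have := size_qgrad n0 gn hn sz; rewrite s1 s2 s3.
  - by have := size_qgrad n0 hn fn sz; rewrite s1 s2 s3.
  - by have := size_qgrad n0 fn gn sz; rewrite s1 s2 s3.
have M0 (M N : {poly L}) : d * M = r * N -> M = 0.
  by rewrite r0 mul0r => /eqP; rewrite mulf_eq0 (negPf d0) => /eqP.
by split; apply/eqP; rewrite -subr_eq0; apply/eqP;
  [exact: (M0 _ _ e3) | exact: (M0 _ _ e1) | exact: (M0 _ _ e2)].
Qed.

(** Dividing by the greatest common divisor reduces to the coprime case, the
    cubic and the Wronskians being homogeneous. *)
Lemma wronskian_eq0 f g h : 3%:R != 0 :> L ->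
    f ^+ 3 + g ^+ 3 + h ^+ 3 = 3%:R * a%:P * (f * g * h) ->
  [/\ f * g^`() = g * f^`(), g * h^`() = h * g^`() & h * f^`() = f * h^`()].
Proof.
move=> n3 C0; have [u [v [w []]]] := bezout3 f g h.
set d := _ + _ => df dg dh.
have [d0|d0] := eqVneq d 0.
  move: df dg dh; rewrite d0 !dvd0p => /eqP-> /eqP-> /eqP->.
  by split; rewrite !mul0r.
have [f' fE] := dvdpP _ _ df; have [g' gE] := dvdpP _ _ dg.
have [h' hE] := dvdpP _ _ dh.
have dE : d = u * f + v * g + w * h by [].
clearbody d; have [] := @wronskian_of_coprime f' g' h' n3.
- by exists u, v, w; apply: (mulIf d0); rewrite mul1r [RHS]dE fE gE hE; ring.
- apply: (mulIf (expf_neq0 3 d0)).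
  transitivity (f ^+ 3 + g ^+ 3 + h ^+ 3); first by rewrite fE gE hE; ring.
  by rewrite C0 fE gE hE; ring.
move=> e1 e2 e3; rewrite fE gE hE !derivM.
split; apply/eqP; rewrite -subr_eq0; apply/eqP.
- transitivity (d ^+ 2 * (f' * g'^`() - g' * f'^`())); first by ring.
  by rewrite e1 subrr mulr0.
- transitivity (d ^+ 2 * (g' * h'^`() - h' * g'^`())); first by ring.
  by rewrite e2 subrr mulr0.
- transitivity (d ^+ 2 * (h' * f'^`() - f' * h'^`())); first by ring.
  by rewrite e3 subrr mulr0.
Qed.
End OneVariable.

(** * Derivations and restriction to lines *)

Section Derivations.
Variables (n : nat) (K : fieldType).
Implicit Types (p : {mpoly K[n]}).

Lemma mpoly_ring_ind (P : {mpoly K[n]} -> Prop) :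
    (forall c, P c%:MP) -> (forall i, P 'X_i) ->
    (forall p q, P p -> P q -> P (p + q)) ->
    (forall p q, P p -> P q -> P (p * q)) ->
  forall p, P p.
Proof.
move=> PC PX PD PM p; rewrite [p]mpolyE.
apply: (big_ind P) => [|//|m _]; first by rewrite -mpolyC0.
rewrite -mul_mpolyC mpolyXE_id; apply: (PM) => //.
apply: (big_ind P) => [|//|i _]; first by rewrite -mpolyC1.
by elim: (m i) => [|k IH]; rewrite ?expr0 -?mpolyC1 // exprS; apply: PM.
Qed.

Lemma mderivXU (i j : 'I_n) : ('X_i : {mpoly K[n]})^`M(j) = (i == j)%:R.
Proof.
rewrite mderivX mnm1E; case: eqP => [->|_]; last by rewrite scale0r.
by rewrite -{1}(add0m U_(j)%MM) addmK scale1r mpolyX0.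
Qed.

Lemma chain_rule (S : comNzRingType) (f : {rmorphism {mpoly K[n]} -> S})
    (D : S -> S) :
    {morph D : a b / a + b} -> (forall a b, D (a * b) = D a * b + a * D b) ->
    (forall c, D (f c%:MP) = 0) ->
  forall p, D (f p) = \sum_(i < n) f p^`M(i) * D (f 'X_i).
Proof.
move=> Dadd Dmul D0; apply: mpoly_ring_ind.
- by move=> c; rewrite D0 big1 // => i _; rewrite mderivC rmorph0 mul0r.
- move=> i; rewrite (bigD1 i) //= big1 ?addr0 => [|j ji].
    by rewrite mderivXU eqxx rmorph1 mul1r.
  by rewrite mderivXU eq_sym (negPf ji) rmorph0 mul0r.
- move=> p q pE qE; rewrite rmorphD Dadd pE qE -big_split /=.
  by apply: eq_bigr => i _; rewrite mderivD rmorphD mulrDl.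
- move=> p q pE qE; rewrite rmorphM Dmul pE qE mulr_suml mulr_sumr -big_split /=.
  by apply: eq_bigr => i _; rewrite mderivM rmorphD !rmorphM /=; ring.
Qed.

Lemma mpoly_rmorph_eq (S : nzRingType) (f g : {rmorphism {mpoly K[n]} -> S}) :
  (forall c, f c%:MP = g c%:MP) -> (forall i, f 'X_i = g 'X_i) -> f =1 g.
Proof.
move=> fgC fgX; apply: mpoly_ring_ind => // p q pE qE.
  by rewrite !rmorphD pE qE.
by rewrite !rmorphM pE qE.
Qed.

End Derivations.

(** Restriction of polynomials to the line through the generic point in the
    direction of the coordinate [j]: this substitutes ['X_j + t] for ['X_j], with
    coefficients in a field [L] that contains the polynomials. It turns a partial
    derivative into the derivative of a polynomial in one variable over a
    field. *)
Section Line.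
Variables (n : nat) (K L : fieldType) (iota : {rmorphism {mpoly K[n]} -> L}).
Variable j : 'I_n.
Notation P := {mpoly K[n]}.

Definition line : P -> {poly L} :=
  mmap (polyC \o iota \o @mpolyC n K)
       (fun i => (iota 'X_i)%:P + (i == j)%:R *: 'X).

HB.instance Definition _ := GRing.RMorphism.on line.

Lemma lineC c : line c%:MP = (iota c%:MP)%:P.
Proof. exact: mmapC. Qed.

Lemma lineX i : line 'X_i = (iota 'X_i)%:P + (i == j)%:R *: 'X.
Proof. by rewrite /line mmapX mmap1U. Qed.

Lemma line_at0 p : (line p).[0] = iota p.
Proof.
pose f := horner_eval (0 : L) \o line.
apply: (mpoly_rmorph_eq (f := f) (g := iota)) => [c|i].
  by rewrite /f /= lineC /horner_eval hornerC.
by rewrite /f /= lineX /horner_eval hornerD hornerC hornerZ hornerX mulr0 addr0.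
Qed.

Lemma deriv_line p : (line p)^`() = line p^`M(j).
Proof.
rewrite (@chain_rule n K {poly L} line (@deriv L)) => [|||c].
- rewrite (bigD1 j) //= big1 ?addr0 => [|i ij].
    by rewrite /= lineX eqxx scale1r derivD derivC derivX add0r mulr1.
  by rewrite /= lineX (negPf ij) scale0r addr0 derivC mulr0.
- exact: derivD.
- exact: derivM.
- by rewrite /= lineC derivC.
Qed.

Hypothesis iota_inj : injective iota.

Lemma mderiv_wronskian_eq0_embed (a : K) (f g h : P) :
    a ^+ 3 != 1 -> 3%:R != 0 :> K ->
    f ^+ 3 + g ^+ 3 + h ^+ 3 = 3%:R * a%:MP * (f * g * h) ->
  [/\ f * g^`M(j) = g * f^`M(j), g * h^`M(j) = h * g^`M(j)
    & h * f^`M(j) = f * h^`M(j)].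
Proof.
move=> a3 n3 C0.
have inj : injective line.
  move=> u v /(congr1 (horner_eval 0)).
  by rewrite /horner_eval !line_at0 => /iota_inj.
have mpC3 (c : K) : (iota c%:MP == 0) = (c == 0).
  by rewrite -(rmorph0 iota) (inj_eq iota_inj) mpolyC_eq0.
have [] := @wronskian_eq0 L (iota a%:MP) _ (line f) (line g) (line h).
- rewrite -subr_eq0 -rmorphXn -(rmorph1 iota) -rmorphB.
  by rewrite -rmorphXn -(rmorph1 (@mpolyC n K)) -rmorphB mpC3 subr_eq0.
- by rewrite -(rmorph_nat iota) -(rmorph_nat (@mpolyC n K)) mpC3.
- rewrite -!rmorphXn -!rmorphD C0 !rmorphM rmorph_nat.
  by rewrite /= lineC.
by rewrite !deriv_line -!rmorphM => /inj ? /inj ? /inj ?.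
Qed.

End Line.

Lemma mderiv_wronskian_eq0 n (K : fieldType) (j : 'I_n) (a : K)
    (f g h : {mpoly K[n]}) :
    a ^+ 3 != 1 -> 3%:R != 0 :> K ->
    f ^+ 3 + g ^+ 3 + h ^+ 3 = 3%:R * a%:MP * (f * g * h) ->
  [/\ f * g^`M(j) = g * f^`M(j), g * h^`M(j) = h * g^`M(j)
    & h * f^`M(j) = f * h^`M(j)].
Proof.
apply: (@mderiv_wronskian_eq0_embed _ _ _ (@tofrac {mpoly K[n]})).
by move=> p q /eqP; rewrite tofrac_eq => /eqP.
Qed.

(** * Forms of top degree *)

Section LeadingForm.
Variables (n : nat) (K : fieldType).
Implicit Types (p q : {mpoly K[n]}) (m : 'X_{1..n}) (d e : nat).

Notation form d p := (pihomog mdeg d p).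

Lemma msize_leP p d :
  reflect (forall m, (d <= mdeg m)%N -> p@_m = 0) (msize p <= d)%N.
Proof.
apply: (iffP idP) => [pd m dm | p0].
  by apply: memN_msupp_eq0; apply: msize_mdeg_ge; apply: leq_trans dm.
rewrite msizeE; apply/bigmax_leqP_seq => m mp _; rewrite ltnNge.
by apply/negP => /p0 /eqP; rewrite mcoeff_eq0 mp.
Qed.

Lemma mcoeff_form d p m : (form d p)@_m = (mdeg m == d)%:R * p@_m.
Proof.
rewrite pihomogE raddf_sum /= -big_filter.
have [pm|pm] := boolP ((mdeg m == d) && (m \in msupp p)).
  have mf : m \in [seq i <- msupp p | mdeg i == d] by rewrite mem_filter.
  rewrite (bigD1_seq m) ?filter_uniq ?msupp_uniq //= big1 ?addr0.
    by case/andP: pm => ->; rewrite mcoeffZ mcoeffX eqxx mulr1 mul1r.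
  by move=> i im; rewrite mcoeffZ mcoeffX (negPf im) mulr0.
rewrite big_seq big1 => [|i].
  move: pm; rewrite negb_and => /orP[/negPf-> | /memN_msupp_eq0 ->].
    by rewrite mul0r.
  by rewrite mulr0.
rewrite mem_filter mcoeffZ mcoeffX => im; case: eqP => [im'|]; last by rewrite mulr0.
by rewrite -im' im in pm.
Qed.

Lemma form_small d p : (msize p <= d)%N -> form d p = 0.
Proof.
move=> /msize_leP p0; apply/mpolyP => m; rewrite mcoeff_form mcoeff0.
by case: eqP => [md|]; rewrite ?mul0r // p0 ?mulr0 // md.
Qed.

Lemma msize_form0 d p : (msize p <= d.+1)%N -> form d p = 0 -> (msize p <= d)%N.
Proof.
move=> /msize_leP pd p0; apply/msize_leP => m; rewrite leq_eqVlt.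
case/orP => [/eqP dm|]; last exact: pd.
by have := mcoeff_form d p m; rewrite p0 mcoeff0 dm eqxx mul1r.
Qed.

Lemma msize_sub_form d p : (msize p <= d.+1)%N -> (msize (p - form d p)%R <= d)%N.
Proof.
move=> /msize_leP pd; apply/msize_leP => m; rewrite mcoeffB mcoeff_form.
rewrite leq_eqVlt => /orP[/eqP ->|dm]; first by rewrite eqxx mul1r subrr.
by rewrite pd // mulr0 subrr.
Qed.

Lemma msizeM_leq p q d e : (msize p <= d.+1)%N -> (msize q <= e.+1)%N ->
  (msize (p * q)%R <= (d + e).+1)%N.
Proof.
move=> pd qe; have [->|p0] := eqVneq p 0; first by rewrite mul0r msize0.
have [->|q0] := eqVneq q 0; first by rewrite mulr0 msize0.
by rewrite msizeM // -subn1 leq_subLR add1n -addnS -addSn leq_add.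
Qed.

(** Without the degree bounds, products of a higher and a lower form would also
    contribute in degree [d + e]. *)
Lemma formM p q d e : (msize p <= d.+1)%N -> (msize q <= e.+1)%N ->
  form (d + e) (p * q) = form d p * form e q.
Proof.
move=> pd qe; set p' := p - form d p; set q' := q - form e q.
have sz0 (r s : {mpoly K[n]}) i j : (msize r <= i)%N -> (msize s <= j.+1)%N ->
    (msize (r * s)%R <= i + j)%N.
  case: i => [|i]; last by rewrite addSn; apply: msizeM_leq.
  by rewrite leqn0 mmeasure_poly_eq0 => /eqP->; rewrite mul0r msize0.
have -> : p * q = form d p * form e q + (form d p * q' + p' * q).
  by rewrite /p' /q'; ring.
have hom : form d p * form e q \is (d + e).-homog.
  by apply: dhomogM; apply: pihomogP.
rewrite pihomogD (pihomog_dE hom) [X in _ + X]form_small ?addr0 //.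
have fd : (msize (form d p) <= d.+1)%N.
  by apply/msize_leP => m dm; rewrite mcoeff_form gtn_eqF ?mul0r.
rewrite (leq_trans (mmeasureD_le _ _ _)) // geq_max (sz0 p') ?msize_sub_form //.
by rewrite andbT mulrC addnC sz0 ?msize_sub_form.
Qed.

Lemma form_mderiv i d p : form d p^`M(i) = (form d.+1 p)^`M(i).
Proof.
apply/mpolyP => m; rewrite mcoeff_form !mcoeff_deriv mcoeff_form.
by rewrite mdegD mdeg1 addn1 eqSS mulrnAr.
Qed.

Lemma msize_mderiv i d p : (msize p <= d.+1)%N -> (msize p^`M(i) <= d)%N.
Proof.
move=> /msize_leP pd; apply/msize_leP => m dm.
by rewrite mcoeff_deriv pd ?mul0rn // mdegD mdeg1 addn1.
Qed.

Lemma euler_homog p d : p \is d.-homog ->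
  \sum_(i < n) 'X_i * p^`M(i) = d%:R * p.
Proof.
move=> /pihomog_dE <-; rewrite pihomogE; apply: (big_ind
  (fun p => \sum_(i < n) 'X_i * p^`M(i) = d%:R * p)) => [|p1 p2 e1 e2|m /eqP md].
- by rewrite mulr0 big1 // => i _; rewrite mderiv0 mulr0.
- rewrite mulrDr -e1 -e2 -big_split; apply: eq_bigr => i _ /=.
  by rewrite mderivD mulrDr.
have <- : mdeg m = d by [].
rewrite mdegE natr_sum mulr_suml; apply: eq_bigr => i _.
rewrite mderivZ mderivX -!scalerAr; case mi: (m i) => [|k].
  by rewrite scale0r mul0r.
rewrite scaler_nat mulr_natl; congr (_ *: (_ *+ _)).
rewrite -mpolyXD addmC submK //; apply/mnm_lepP => j.
by rewrite mnm1E; case: eqP => // <-; rewrite mi.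
Qed.

End LeadingForm.

(** * The elliptic bracket and polynomial substitutions *)

(** The Cauchy-Binet formula for a 2 x 3 matrix [(a, b)] and a 3 x 3 matrix
    [(f, g, h)], contracted with a vector [n]. With [n] the gradient of the
    casimir, [br] is the bracket of two polynomials in terms of their partial
    derivatives. *)
Lemma cauchy_binet23 (R : comNzRingType) (a0 a1 a2 b0 b1 b2 : R)
    (f0 f1 f2 g0 g1 g2 h0 h1 h2 n0 n1 n2 : R) :
  let br u0 u1 u2 v0 v1 v2 := (u1 * v2 - u2 * v1) * n0
    + (u2 * v0 - u0 * v2) * n1 + (u0 * v1 - u1 * v0) * n2 in
  (a1 * b2 - a2 * b1) * br g0 g1 g2 h0 h1 h2
  + (a2 * b0 - a0 * b2) * br h0 h1 h2 f0 f1 f2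
  + (a0 * b1 - a1 * b0) * br f0 f1 f2 g0 g1 g2 =
  br (a0 * f0 + a1 * g0 + a2 * h0) (a0 * f1 + a1 * g1 + a2 * h1)
    (a0 * f2 + a1 * g2 + a2 * h2) (b0 * f0 + b1 * g0 + b2 * h0)
    (b0 * f1 + b1 * g1 + b2 * h1) (b0 * f2 + b1 * g2 + b2 * h2).
Proof. by rewrite /=; ring. Qed.

Section Bracket.
Variable K : fieldType.
Notation P := {mpoly K[3]}.
Implicit Types (u v w f g h : P).

Lemma ord3P (i : 'I_3) : [\/ i = 0, i = 1 | i = 2].
Proof.
by case: i => [[|[|[|//]]] lti]; [constructor 1|constructor 2|constructor 3];
  apply: val_inj.
Qed.

Lemma sum_ord3 (V : zmodType) (F : 'I_3 -> V) : \sum_(i < 3) F i = F 0 + F 1 + F 2.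
Proof.
rewrite !big_ord_recl big_ord0 addr0 addrA.
by congr (_ + _ + _); congr F; apply: val_inj.
Qed.

Variable alpha : K.
Notation q := (qgrad alpha%:MP_[3]).
Notation N1 := (q varx vary varz).
Notation N2 := (q vary varz varx).
Notation N3 := (q varz varx vary).

Hypothesis charK : [pchar K] =i pred0.

Lemma natr_neq0 n : n.+1%:R != 0 :> K.
Proof. by rewrite ((pcharf0P K).1 charK). Qed.

Lemma mderiv_casimir :
  [/\ (casimir alpha)^`M(0) = N1, (casimir alpha)^`M(1) = N2
    & (casimir alpha)^`M(2) = N3].
Proof.
have dX3 (i j : 'I_3) : ('X_j ^+ 3 : P)^`M(i) = 3%:R *: ((j == i)%:R * 'X_j ^+ 2).
  by rewrite !exprS expr0 mulr1 !mderivM !mderivXU scaler_nat; ring.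
have dC (i : 'I_3) : (casimir alpha)^`M(i) =
    (0 == i)%:R * varx ^+ 2 + (1 == i)%:R * vary ^+ 2 + (2 == i)%:R * varz ^+ 2
    - alpha%:MP * ((0 == i)%:R * (vary * varz) + (1 == i)%:R * (varx * varz)
      + (2 == i)%:R * (varx * vary)).
  rewrite /casimir /varx /vary /varz mderivB !mderivZ !mderivD !dX3 !mderivM.
  rewrite !mderivXU -!scalerDr scalerA mulVf ?natr_neq0 // scale1r -mul_mpolyC.
  ring.
by split; rewrite dC /= /qgrad; ring.
Qed.

Lemma elliptic_bracketE u v : elliptic_bracket alpha u v =
    (u^`M(1) * v^`M(2) - u^`M(2) * v^`M(1)) * N1
  + (u^`M(2) * v^`M(0) - u^`M(0) * v^`M(2)) * N2
  + (u^`M(0) * v^`M(1) - u^`M(1) * v^`M(0)) * N3.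
Proof.
have [e1 e2 e3] := mderiv_casimir.
by rewrite /elliptic_bracket jacobianE e1 e2 e3; ring.
Qed.

Definition subst f g h : P -> P := comp_mpoly [tuple f; g; h].

HB.instance Definition _ f g h := GRing.LRMorphism.on (subst f g h).

Lemma subst_var f g h :
  [/\ subst f g h varx = f, subst f g h vary = g & subst f g h varz = h].
Proof. by split; rewrite /subst comp_mpolyXU. Qed.

Lemma substC f g h c : subst f g h c%:MP = c%:MP.
Proof. exact: comp_mpolyC. Qed.

Lemma mderiv_subst f g h p (j : 'I_3) : (subst f g h p)^`M(j) =
  subst f g h p^`M(0) * f^`M(j) + subst f g h p^`M(1) * g^`M(j)
  + subst f g h p^`M(2) * h^`M(j).
Proof.
have := @chain_rule 3 K P (subst f g h) (mderiv j) _ _ _ p.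
rewrite sum_ord3 /=; have [-> -> ->] := subst_var f g h; apply.
- exact: mderivD.
- exact: mderivM.
- by move=> c; rewrite /= substC mderivC.
Qed.

Lemma subst_qgrad f g h u v w :
  subst f g h (q u v w) = q (subst f g h u) (subst f g h v) (subst f g h w).
Proof. by rewrite /qgrad rmorphB rmorphXn !rmorphM /= substC. Qed.

(** The bracket relations that [f, g, h] must satisfy for the substitution of
    [f, g, h] for the variables to be Poisson; see [subst_bracket]. *)
Definition poisson_triple f g h :=
  [/\ elliptic_bracket alpha g h = q f g h, elliptic_bracket alpha h f = q g h f
    & elliptic_bracket alpha f g = q h f g].

Lemma subst_bracket f g h u v : poisson_triple f g h ->
  subst f g h (elliptic_bracket alpha u v) =
  elliptic_bracket alpha (subst f g h u) (subst f g h v).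
Proof.
move=> [e1 e2 e3]; rewrite [in LHS]elliptic_bracketE.
have [eX eY eZ] := subst_var f g h.
have sN1 : subst f g h N1 = elliptic_bracket alpha g h.
  by rewrite subst_qgrad eX eY eZ e1.
have sN2 : subst f g h N2 = elliptic_bracket alpha h f.
  by rewrite subst_qgrad eX eY eZ e2.
have sN3 : subst f g h N3 = elliptic_bracket alpha f g.
  by rewrite subst_qgrad eX eY eZ e3.
move: sN1 sN2 sN3; rewrite !elliptic_bracketE !mderiv_subst.
set n1 := N1; set n2 := N2; set n3 := N3 => sN1 sN2 sN3.
clearbody n1 n2 n3; rewrite !(rmorphD, rmorphN, rmorphM) /=.
rewrite sN1 sN2 sN3; exact: cauchy_binet23.
Qed.

Lemma subst_varP (phi : P -> P) : linear phi -> {morph phi : a b / a * b} ->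
  phi 1 = 1 -> phi =1 subst (phi varx) (phi vary) (phi varz).
Proof.
move=> philin phiM phi1.
have phiD : {morph phi : a b / a + b}.
  by move=> a b; have := philin 1 a b; rewrite !scale1r.
apply: mpoly_ring_ind => [c|i|p r pE rE|p r pE rE].
- have := philin c 1 0; rewrite phi1 !addr0.
  have -> : phi 0 = 0 by apply: (addIr (phi 0)); rewrite -phiD !add0r.
  by rewrite addr0 substC -[c%:MP]mulr1 mul_mpolyC.
- have [eX eY eZ] := subst_var (phi varx) (phi vary) (phi varz).
  by case: (ord3P i) => ->; symmetry.
- by rewrite phiD pE rE rmorphD.
- by rewrite phiM pE rE rmorphM.
Qed.

Lemma subst_cancel f g h f' g' h' :
    [/\ subst f g h f' = varx, subst f g h g' = vary & subst f g h h' = varz] ->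
  cancel (subst f' g' h') (subst f g h).
Proof.
move=> [eX eY eZ]; pose s := subst f g h \o subst f' g' h'.
apply: (mpoly_rmorph_eq (f := s) (g := idfun)) => [c|i]; rewrite /s /=.
  by rewrite !substC.
have [eX' eY' eZ'] := subst_var f' g' h'.
by case: (ord3P i) => ->; [rewrite eX' eX|rewrite eY' eY|rewrite eZ' eZ].
Qed.

Lemma subst_poisson f g h f' g' h' :
    poisson_triple f g h ->
    [/\ subst f g h f' = varx, subst f g h g' = vary & subst f g h h' = varz] ->
    [/\ subst f' g' h' f = varx, subst f' g' h' g = vary & subst f' g' h' h = varz] ->
  poisson_aut (elliptic_bracket alpha) (subst f g h).
Proof.
move=> fgh sub1 sub2; split.
- by exists (subst f' g' h'); apply: subst_cancel.
- exact: linearP.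
- exact: rmorphM.
- by move=> u v; apply: subst_bracket.
Qed.

Lemma poisson_aut_subst (phi : P -> P) :
  poisson_aut (elliptic_bracket alpha) phi ->
  exists f g h f' g' h', [/\ phi =1 subst f g h, poisson_triple f g h
    & cancel (subst f' g' h') (subst f g h)].
Proof.
have algP (phi1 psi : P -> P) : poisson_aut (elliptic_bracket alpha) phi1 ->
    cancel psi phi1 -> phi1 =1 subst (phi1 varx) (phi1 vary) (phi1 varz).
  move=> [_ lin mul _] psiK; apply: subst_varP => //.
  (* phi1 1 is a unit element for the image of phi1, which contains 1. *)
  by rewrite -[LHS]mul1r -{1}[1]psiK -mul mulr1 psiK.
move=> phi_aut; have [[psi phiK psiK] lin mul br] := phi_aut.
have phiE := algP _ _ phi_aut psiK.
have psiE := algP _ _ (poisson_aut_inv phi_aut phiK psiK) phiK.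
exists (phi varx), (phi vary), (phi varz), (psi varx), (psi vary), (psi varz).
split=> [//||p]; last by rewrite -psiE -phiE psiK.
have e (a b c : P) : phi (q a b c) = q (phi a) (phi b) (phi c).
  have [eX eY eZ] := subst_var (phi varx) (phi vary) (phi varz).
  by rewrite [LHS]phiE subst_qgrad -!phiE.
rewrite /poisson_triple -!br -!e !elliptic_bracketE /varx /vary /varz !mderivXU.
by split; congr phi; rewrite /=; ring.
Qed.

(** By the chain rule, the product of the Jacobian matrices of a substitution and
    of its inverse is the identity. *)
Lemma jacobian_unit f g h f' g' h' : cancel (subst f' g' h') (subst f g h) ->
  jacobian f g h \is a GRing.unit.
Proof.
move=> sK; pose A := \matrix_(i < 3, j < 3) ([:: f; g; h]`_i)^`M(j).
pose B := \matrix_(i < 3, j < 3) subst f g h ([:: f'; g'; h']`_i)^`M(j).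
have BA : B *m A = 1%:M.
  apply/matrixP => i j; rewrite !mxE sum_ord3 !mxE /= -mderiv_subst.
  have [eX eY eZ] := subst_var f' g' h'.
  rewrite -mderivXU; congr (_^`M(_)).
  by case: (ord3P i) => -> /=; [rewrite -eX sK|rewrite -eY sK|rewrite -eZ sK].
have : \det B * \det A = 1 by rewrite -det_mulmx BA det1.
by move=> e; apply/unitrPr; exists (\det B); rewrite mulrC.
Qed.

End Bracket.

(** * Poisson triples have degree one *)

Section Degree.
Variables (K : fieldType) (alpha : K).
Hypotheses (charK : [pchar K] =i pred0) (alpha3 : alpha ^+ 3 != 1).
Notation P := {mpoly K[3]}.
Implicit Types (u v w f g h : P) (d e : nat).
Notation q := (qgrad alpha%:MP_[3]).
Notation form d p := (pihomog mdeg d p).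

(** The three bracket relations say that the cofactor matrix of the Jacobian
    matrix maps the gradient of the casimir to the gradient at [(f, g, h)].
    Multiplying by the transposed Jacobian matrix gives zero, and by Euler's
    identity [(f, g, h)] lies on the cubic. Hence all the Wronskians of [f, g, h]
    vanish, and so do their brackets, which are the components of the gradient
    at [(f, g, h)]; by smoothness [f = g = h = 0]. *)
Lemma poisson_triple_homog_eq0 d f g h :
    f \is d.+1.-homog -> g \is d.+1.-homog -> h \is d.+1.-homog ->
    poisson_triple alpha f g h -> jacobian f g h = 0 ->
  [/\ f = 0, g = 0 & h = 0].
Proof.
move=> homf homg homh [e1 e2 e3] J0.
have C0 : f * q f g h + g * q g h f + h * q h f g = 0.
  have grad0 (j : 'I_3) :
      f^`M(j) * q f g h + g^`M(j) * q g h f + h^`M(j) * q h f g = 0.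
    pose n (j : 'I_3) : P := (casimir alpha)^`M(j).
    transitivity (jacobian f g h * n j); last by rewrite J0 mul0r.
    rewrite -e1 -e2 -e3 /elliptic_bracket !jacobianE -/(n 0) -/(n 1) -/(n 2).
    by clearbody n; case: (ord3P j) => ->; ring.
  have d0 : d.+1%:R != 0 :> P 
    by rewrite -(rmorph_nat (@mpolyC 3 K)) mpolyC_eq0 natr_neq0.
  move: (grad0 0) (grad0 1) (grad0 2).
  move: (q f g h) (q g h f) (q h f g) => n1 n2 n3 g0 g1 g2.
  apply: (mulfI d0); rewrite mulr0 !mulrDr !mulrA.
  rewrite -(euler_homog homf) -(euler_homog homg) -(euler_homog homh) !sum_ord3.
  transitivity ('X_0 * (f^`M(0) * n1 + g^`M(0) * n2 + h^`M(0) * n3)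
    + 'X_1 * (f^`M(1) * n1 + g^`M(1) * n2 + h^`M(1) * n3)
    + 'X_2 * (f^`M(2) * n1 + g^`M(2) * n2 + h^`M(2) * n3)); first by ring.
  by rewrite g0 g1 g2 !mulr0 !addr0.
have wron j := @mderiv_wronskian_eq0 3 K j alpha f g h alpha3 (natr_neq0 charK 2).
have {wron} wron j : [/\ f * g^`M(j) = g * f^`M(j), g * h^`M(j) = h * g^`M(j)
    & h * f^`M(j) = f * h^`M(j)].
  by apply: wron; apply/eqP; rewrite -subr_eq0 -qgrad_euler C0.
have br0 u v : (forall j, u * v^`M(j) = v * u^`M(j)) ->
    elliptic_bracket alpha u v = 0.
  move=> uv; have [->|u0] := eqVneq u 0.
    by rewrite /elliptic_bracket jacobianE !mderiv0; ring.
  apply: (mulfI u0); rewrite mulr0 /elliptic_bracket jacobianE.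
  move: (casimir alpha) => c.
  transitivity (u^`M(0) * ((u * v^`M(1)) * c^`M(2) - (u * v^`M(2)) * c^`M(1))
    - u^`M(1) * ((u * v^`M(0)) * c^`M(2) - (u * v^`M(2)) * c^`M(0))
    + u^`M(2) * ((u * v^`M(0)) * c^`M(1) - (u * v^`M(1)) * c^`M(0))).
    by ring.
  by rewrite !uv; ring.
apply: (@qgrad_eq0 _ alpha%:MP); rewrite -?e1 -?e2 -?e3.
- rewrite -subr_eq0 -(rmorphXn (@mpolyC 3 K)) -(rmorph1 (@mpolyC 3 K)) -rmorphB.
  by rewrite mpolyC_eq0 subr_eq0.
- by apply: br0 => j; have [] := wron j.
- by apply: br0 => j; have [] := wron j.
- by apply: br0 => j; have [] := wron j.
Qed.

Lemma qgrad_homog u v w :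
    [/\ u \is 1.-homog, v \is 1.-homog & w \is 1.-homog] ->
  q u v w \is 2.-homog.
Proof.
move=> [hu hv hw]; rewrite /qgrad rpredB //; first exact: (dhomogMn 2 hu).
by rewrite mul_mpolyC dhomogZ // (dhomogM hv hw).
Qed.

Lemma form_qgrad d u v w :
    (msize u <= d.+1)%N -> (msize v <= d.+1)%N -> (msize w <= d.+1)%N ->
  form (d + d) (q u v w) = q (form d u) (form d v) (form d w).
Proof.
move=> ud vd wd; rewrite /qgrad !expr2 raddfB /= formM //.
by rewrite !mul_mpolyC linearZ /= formM.
Qed.

Lemma form_bracket d u v : (msize u <= d.+2)%N -> (msize v <= d.+2)%N ->
  form (d.+1 + d.+1) (elliptic_bracket alpha u v) =
  elliptic_bracket alpha (form d.+1 u) (form d.+1 v).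
Proof.
move=> ud vd; rewrite !elliptic_bracketE // -!form_mderiv.
have var1 (i : 'I_3) : ('X_i : P) \is 1.-homog by rewrite dhomogX /= mdeg1.
have fN (p N : P) : (msize p <= (d + d).+1)%N -> N \is 2.-homog ->
    form (d.+1 + d.+1) (p * N) = form (d + d) p * N.
  move=> pd hN; rewrite -{2}(pihomog_dE hN) -formM //.
    by congr (form _ _); lia.
  apply/msize_leP => m dm; apply: (dhomog_nemf_coeff hN).
  by apply: contraTneq dm => ->.
have fm (i j : 'I_3) :
    (msize (u^`M(i) * v^`M(j) - u^`M(j) * v^`M(i))%R <= (d + d).+1)%N.
  rewrite (leq_trans (mmeasureD_le _ _ _)) // mmeasureN geq_max.
  by rewrite !msizeM_leq ?msize_mderiv.
have hN : [/\ q varx vary varz \is 2.-homog, q vary varz varx \is 2.-homog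
    & q varz varx vary \is 2.-homog].
  by split; apply: qgrad_homog; split; apply: var1.
have [h1 h2 h3] := hN.
by rewrite !raddfD /= !fN // !raddfB /= !formM ?msize_mderiv.
Qed.

Lemma poisson_triple_form d f g h :
    (msize f <= d.+2)%N -> (msize g <= d.+2)%N -> (msize h <= d.+2)%N ->
    poisson_triple alpha f g h ->
  poisson_triple alpha (form d.+1 f) (form d.+1 g) (form d.+1 h).
Proof.
move=> fd gd hd [e1 e2 e3].
by split; rewrite -form_bracket // -form_qgrad // ?e1 ?e2 ?e3.
Qed.

Lemma form_jacobian d f g h :
    (msize f <= d.+2)%N -> (msize g <= d.+2)%N -> (msize h <= d.+2)%N ->
  form (d + (d + d)) (jacobian f g h) =
  jacobian (form d.+1 f) (form d.+1 g) (form d.+1 h).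
Proof.
move=> fd gd hd; rewrite !jacobianE -!form_mderiv.
have sz2 (u v : P) (i j : 'I_3) : (msize u <= d.+2)%N -> (msize v <= d.+2)%N ->
    (msize (u^`M(i) * v^`M(j) - u^`M(j) * v^`M(i))%R <= (d + d).+1)%N.
  move=> ud vd; rewrite (leq_trans (mmeasureD_le _ _ _)) // mmeasureN geq_max.
  by rewrite !msizeM_leq ?msize_mderiv.
rewrite raddfD raddfB /= !formM ?msize_mderiv ?sz2 // !raddfB /=.
by rewrite !formM ?msize_mderiv.
Qed.

(** In degree at least two the Jacobian determinant of the forms of top degree is
    a component of positive degree of a constant, so
    [poisson_triple_homog_eq0] applies to these forms. *)
Lemma poisson_triple_msize_step d f g h :
    poisson_triple alpha f g h -> jacobian f g h \is a GRing.unit ->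
    (msize f <= d.+3)%N -> (msize g <= d.+3)%N -> (msize h <= d.+3)%N ->
  [/\ (msize f <= d.+2)%N, (msize g <= d.+2)%N & (msize h <= d.+2)%N].
Proof.
move=> fgh Junit fd gd hd.
have J0 : jacobian (form d.+2 f) (form d.+2 g) (form d.+2 h) = 0.
  rewrite -form_jacobian // form_small //.
  have /unitrPr[J' JJ'] := Junit; have := oner_neq0 P; rewrite -JJ' mulf_eq0.
  case/norP => J1 J2; have := congr1 (fun p : P => msize p) JJ'.
  rewrite msizeM // msize1; move: J1 J2; rewrite -!msize_poly_eq0.
  by move: (msize J') (msize (jacobian f g h)) => [|k] [|[|m]] //=; rewrite addnS.
have [] := poisson_triple_homog_eq0 (pihomogP _ _ f) (pihomogP _ _ g)
  (pihomogP _ _ h) (poisson_triple_form fd gd hd fgh) J0.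
by move=> f0 g0 h0; split; apply: msize_form0.
Qed.

Lemma poisson_triple_msize f g h :
    poisson_triple alpha f g h -> jacobian f g h \is a GRing.unit ->
  [/\ (msize f <= 2)%N, (msize g <= 2)%N & (msize h <= 2)%N].
Proof.
move=> fgh Junit.
have [n [fn gn hn]] : exists n,
    [/\ (msize f <= n.+2)%N, (msize g <= n.+2)%N & (msize h <= n.+2)%N].
  move: (msize f) (msize g) (msize h) => a b c.
  by exists (a + b + c)%N; split; lia.
elim: n fn gn hn => [//|n IH] fn gn hn.
by have [] := poisson_triple_msize_step fgh Junit fn gn hn.
Qed.

End Degree.

(** * The linear Poisson triples *)

Section Matrix.
Variables (K : fieldType) (a : K).
Notation q := (qgrad a).

(** One of the three bracket relations for affine [f, g, h] with linear
    coefficients [(p, q, r)] and constant terms [c], evaluated at all points. At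
    the origin it gives the equation for [c]; at the coordinate vectors, the
    coefficients of the squares; at the sums of two of them, the mixed
    coefficients, which the former simplify to binomial equations. *)
Lemma qgrad_linear_coef (c1 c2 c3 p1 p2 p3 q1 q2 q3 r1 r2 r3 : K) : 2%:R != 0 :> K ->
    (forall x y z : K,
      q (c1 + p1 * x + q1 * y + r1 * z) (c2 + p2 * x + q2 * y + r2 * z)
        (c3 + p3 * x + q3 * y + r3 * z) =
      (q2 * r3 - q3 * r2) * q x y z + (r2 * p3 - r3 * p2) * q y z x
      + (p2 * q3 - p3 * q2) * q z x y) ->
  q c1 c2 c3 = 0 /\ (c1 = 0 -> c2 = 0 -> c3 = 0 ->
  [/\ q p1 p2 p3 = q2 * r3 - q3 * r2, q q1 q2 q3 = r2 * p3 - r3 * p2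
    & q r1 r2 r3 = p2 * q3 - p3 * q2] /\
  [/\ q1 * r1 = a * (q3 * r2), r1 * p1 = a * (r3 * p2) & p1 * q1 = a * (p3 * q2)]).
Proof.
move=> n2 E; split; first by have := E 0 0 0; rewrite /qgrad !mulr0 !addr0 => ->; ring.
move=> c10 c20 c30; rewrite c10 c20 c30 {c1 c2 c3 c10 c20 c30} in E.
have Ep : q p1 p2 p3 = q2 * r3 - q3 * r2.
  transitivity (q (0 + p1 * 1 + q1 * 0 + r1 * 0) (0 + p2 * 1 + q2 * 0 + r2 * 0)
    (0 + p3 * 1 + q3 * 0 + r3 * 0)); last rewrite E; rewrite /qgrad; ring.
have Eq : q q1 q2 q3 = r2 * p3 - r3 * p2.
  transitivity (q (0 + p1 * 0 + q1 * 1 + r1 * 0) (0 + p2 * 0 + q2 * 1 + r2 * 0)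
    (0 + p3 * 0 + q3 * 1 + r3 * 0)); last rewrite E; rewrite /qgrad; ring.
have Er : q r1 r2 r3 = p2 * q3 - p3 * q2.
  transitivity (q (0 + p1 * 0 + q1 * 0 + r1 * 1) (0 + p2 * 0 + q2 * 0 + r2 * 1)
    (0 + p3 * 0 + q3 * 0 + r3 * 1)); last rewrite E; rewrite /qgrad; ring.
split=> //; split; apply: (mulfI n2); apply/eqP; rewrite -subr_eq0; apply/eqP.
- transitivity (q (0 + p1 * 0 + q1 * 1 + r1 * 1) (0 + p2 * 0 + q2 * 1 + r2 * 1)
    (0 + p3 * 0 + q3 * 1 + r3 * 1) - q q1 q2 q3 - q r1 r2 r3
    - (- a * (q2 * r3 - q3 * r2))); first by rewrite /qgrad; ring.
  by rewrite E Eq Er /qgrad; ring.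
- transitivity (q (0 + p1 * 1 + q1 * 0 + r1 * 1) (0 + p2 * 1 + q2 * 0 + r2 * 1)
    (0 + p3 * 1 + q3 * 0 + r3 * 1) - q p1 p2 p3 - q r1 r2 r3
    - (- a * (r2 * p3 - r3 * p2))); first by rewrite /qgrad; ring.
  by rewrite E Ep Er /qgrad; ring.
- transitivity (q (0 + p1 * 1 + q1 * 1 + r1 * 0) (0 + p2 * 1 + q2 * 1 + r2 * 0)
    (0 + p3 * 1 + q3 * 1 + r3 * 0) - q p1 p2 p3 - q q1 q2 q3
    - (- a * (p2 * q3 - p3 * q2))); first by rewrite /qgrad; ring.
  by rewrite E Ep Eq /qgrad; ring.
Qed.

(** The condition for the diagonal substitution with entries [u, v, w] to be
    Poisson; see [diag_triple]. *)
Definition cyclic_rel (u v w : K) :=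
  [/\ u ^+ 2 = v * w, v ^+ 2 = w * u & w ^+ 2 = u * v].

Hypothesis a3 : a ^+ 3 != 1.

(** The nine equations have the form [s = a * t] with [s] and [t] products of two
    entries. For some triples of equations the product of the three left-hand
    sides is also the product of the three monomials [t], hence is [a ^+ 3] times
    itself and vanishes. The six vanishing products obtained in this way and the
    nine equations constrain which of [a] and the entries are zero. Together with
    the condition that no column is zero, these boolean constraints leave the six
    patterns of permutation matrices (three even, then three odd), which is
    decided by enumeration. *)
Lemma monomial_of_rel (p1 p2 p3 q1 q2 q3 r1 r2 r3 : K) :
    ~~ [&& p1 == 0, p2 == 0 & p3 == 0] -> ~~ [&& q1 == 0, q2 == 0 & q3 == 0] ->
    ~~ [&& r1 == 0, r2 == 0 & r3 == 0] ->
    [/\ q1 * r1 = a * (q3 * r2), q2 * r2 = a * (q1 * r3) & q3 * r3 = a * (q2 * r1)] ->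
    [/\ r1 * p1 = a * (r3 * p2), r2 * p2 = a * (r1 * p3) & r3 * p3 = a * (r2 * p1)] ->
    [/\ p1 * q1 = a * (p3 * q2), p2 * q2 = a * (p1 * q3) & p3 * q3 = a * (p2 * q1)] ->
  map (fun t : K => t == 0) [:: p1; p2; p3; q1; q2; q3; r1; r2; r3] \in
    [:: [:: false; true; true; true; false; true; true; true; false];
        [:: true; false; true; true; true; false; false; true; true];
        [:: true; true; false; false; true; true; true; false; true];
        [:: false; true; true; true; true; false; true; false; true];
        [:: true; false; true; false; true; true; true; true; false];
        [:: true; true; false; true; false; true; false; true; true]].
Proof.
move=> p0 q0 r0 [d1 d2 d3] [e1 e2 e3] [g1 g2 g3].
have prod0 (s1 s2 s3 t1 t2 t3 : K) : s1 = a * t1 -> s2 = a * t2 -> s3 = a * t3 ->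
    t1 * t2 * t3 = s1 * s2 * s3 -> s1 * s2 * s3 == 0.
  move=> h1 h2 h3 ts; have : (1 - a ^+ 3) * (s1 * s2 * s3) == 0.
    rewrite mulrBl mul1r subr_eq0 -{2}ts h1 h2 h3; apply/eqP; ring.
  by rewrite mulf_eq0 subr_eq0 eq_sym (negPf a3).
have z1 : (q1 * r1) * (r2 * p2) * (p3 * q3) == 0.
  by apply: (prod0 _ _ _ _ _ _ d1 e2 g3); ring.
have z2 : (q2 * r2) * (r3 * p3) * (p1 * q1) == 0.
  by apply: (prod0 _ _ _ _ _ _ d2 e3 g1); ring.
have z3 : (q3 * r3) * (r1 * p1) * (p2 * q2) == 0.
  by apply: (prod0 _ _ _ _ _ _ d3 e1 g2); ring.
have zq : (q1 * r1) * (q2 * r2) * (q3 * r3) == 0.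
  by apply: (prod0 _ _ _ _ _ _ d1 d2 d3); ring.
have zr : (r1 * p1) * (r2 * p2) * (r3 * p3) == 0.
  by apply: (prod0 _ _ _ _ _ _ e1 e2 e3); ring.
have zp : (p1 * q1) * (p2 * q2) * (p3 * q3) == 0.
  by apply: (prod0 _ _ _ _ _ _ g1 g2 g3); ring.
have flag (s t u v : K) : s * t = a * (u * v) ->
    (s == 0) || (t == 0) = [|| a == 0, u == 0 | v == 0].
  by move=> h; rewrite -!mulf_eq0 h mulf_eq0.
move: (flag _ _ _ _ d1) (flag _ _ _ _ d2) (flag _ _ _ _ d3) (flag _ _ _ _ e1)
  (flag _ _ _ _ e2) (flag _ _ _ _ e3) (flag _ _ _ _ g1) (flag _ _ _ _ g2)
  (flag _ _ _ _ g3) p0 q0 r0 z1 z2 z3 zq zr zp => {d1 d2 d3 e1 e2 e3 g1 g2 g3}.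
rewrite !mulf_eq0 /= !inE.
move: (a == 0) (p1 == 0) (p2 == 0) (p3 == 0) (q1 == 0) (q2 == 0) (q3 == 0)
  (r1 == 0) (r2 == 0) (r3 == 0).
by do 10![case].
Qed.

(** The equations for an odd permutation matrix: the cubes of the three entries
    equal [- (u * v * w)], whose own cube then has both signs. *)
Lemma odd_pattern_absurd (u v w : K) : 2%:R != 0 :> K -> u != 0 ->
  u ^+ 2 = - (v * w) -> v ^+ 2 = - (w * u) -> w ^+ 2 = - (u * v) -> False.
Proof.
move=> n2 u0 hu hv hw.
have hu3 : u ^+ 3 = - (u * v * w) by rewrite exprS hu; ring.
have hv3 : v ^+ 3 = - (u * v * w) by rewrite exprS hv; ring.
have hw3 : w ^+ 3 = - (u * v * w) by rewrite exprS hw; ring.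
have : 2%:R * (u ^+ 3) ^+ 3 = 0.
  have h : (u ^+ 3) ^+ 3 = - (u ^+ 3) ^+ 3.
    by rewrite {1}hu3 exprNn !exprMn hv3 hw3 -hu3; ring.
  by rewrite mulr_natl mulr2n {1}h addNr.
by move/eqP; rewrite mulf_eq0 (negPf n2) !expf_eq0 (negPf u0).
Qed.

(** The hypotheses collect the coefficients of the three bracket relations for
    linear [f, g, h] with coefficient vectors [p, q, r] of x, y, z. The three
    cases of the conclusion are the even permutation matrices. *)
Lemma linear_triple (p1 p2 p3 q1 q2 q3 r1 r2 r3 : K) : 2%:R != 0 :> K ->
    ~~ [&& p1 == 0, q1 == 0 & r1 == 0] ->
    [/\ q p1 p2 p3 = q2 * r3 - q3 * r2, q q1 q2 q3 = r2 * p3 - r3 * p2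
      & q r1 r2 r3 = p2 * q3 - p3 * q2] /\
    [/\ q1 * r1 = a * (q3 * r2), r1 * p1 = a * (r3 * p2) & p1 * q1 = a * (p3 * q2)] ->
    [/\ q p2 p3 p1 = q3 * r1 - q1 * r3, q q2 q3 q1 = r3 * p1 - r1 * p3
      & q r2 r3 r1 = p3 * q1 - p1 * q3] /\
    [/\ q2 * r2 = a * (q1 * r3), r2 * p2 = a * (r1 * p3) & p2 * q2 = a * (p1 * q3)] ->
    [/\ q p3 p1 p2 = q1 * r2 - q2 * r1, q q3 q1 q2 = r1 * p2 - r2 * p1
      & q r3 r1 r2 = p1 * q2 - p2 * q1] /\
    [/\ q3 * r3 = a * (q2 * r1), r3 * p3 = a * (r2 * p1) & p3 * q3 = a * (p2 * q1)] ->
  [\/ [/\ cyclic_rel p1 q2 r3, p1 != 0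
        & [/\ p2 = 0, p3 = 0, q1 = 0, q3 = 0 & r1 = 0 /\ r2 = 0]],
      [/\ cyclic_rel p2 q3 r1, p2 != 0
        & [/\ p1 = 0, p3 = 0, q1 = 0, q2 = 0 & r2 = 0 /\ r3 = 0]]
    | [/\ cyclic_rel p3 q1 r2, p3 != 0
        & [/\ p1 = 0, p2 = 0, q2 = 0, q3 = 0 & r1 = 0 /\ r3 = 0]]].
Proof.
move=> n2 row1 [[A1 B1 C1] [D1 E1 G1]] [[A2 B2 C2] [D2 E2 G2]] [[A3 B3 C3] [D3 E3 G3]].
have nz (u1 u2 u3 v1 v2 v3 w1 w2 w3 : K) :
    q v1 v2 v3 = w2 * u3 - w3 * u2 -> q v2 v3 v1 = w3 * u1 - w1 * u3 ->
    q v3 v1 v2 = w1 * u2 - w2 * u1 ->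
    [&& u1 == 0, u2 == 0 & u3 == 0] -> [&& v1 == 0, v2 == 0 & v3 == 0].
  move=> h1 h2 h3 /and3P[/eqP u10 /eqP u20 /eqP u30].
  move: h1 h2 h3; rewrite u10 u20 u30 !mulr0 !subrr => h1 h2 h3.
  by have [-> -> ->] := qgrad_eq0 a3 h1 h2 h3; rewrite eqxx.
have nzpq := nz p1 p2 p3 q1 q2 q3 r1 r2 r3 B1 B2 B3.
have nzqr := nz q1 q2 q3 r1 r2 r3 p1 p2 p3 C1 C2 C3.
have nzrp := nz r1 r2 r3 p1 p2 p3 q1 q2 q3 A1 A2 A3.
(* If a column is zero, so is the gradient at the next one, hence all are. *)
have [p0 q0 r0] : [/\ ~~ [&& p1 == 0, p2 == 0 & p3 == 0],
    ~~ [&& q1 == 0, q2 == 0 & q3 == 0] & ~~ [&& r1 == 0, r2 == 0 & r3 == 0]].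
  split; apply: contra row1 => z.
  - have zq := nzpq z; have zr := nzqr zq.
    by move: z zq zr => /and3P[-> _ _] /and3P[-> _ _] /and3P[-> _ _].
  - have zr := nzqr z; have zp := nzrp zr.
    by move: z zr zp => /and3P[-> _ _] /and3P[-> _ _] /and3P[-> _ _].
  - have zp := nzrp z; have zq := nzpq zp.
    by move: z zp zq => /and3P[-> _ _] /and3P[-> _ _] /and3P[-> _ _].
have := monomial_of_rel p0 q0 r0 (And3 D1 D2 D3) (And3 E1 E2 E3) (And3 G1 G2 G3).
move: {D1 D2 D3 E1 E2 E3 G1 G2 G3 nz nzpq nzqr nzrp p0 q0 r0 row1}
  A1 A2 A3 B1 B2 B3 C1 C2 C3.
rewrite /qgrad /cyclic_rel => A1 A2 A3 B1 B2 B3 C1 C2 C3.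
rewrite !inE => /or4P[|||/or3P[||]] /eqP.
- move=> [zp1 /eqP zp2 /eqP zp3 /eqP zq1 zq2 /eqP zq3 /eqP zr1 /eqP zr2 zr3].
  move: A1 B2 C3; rewrite zp2 zp3 zq1 zq3 zr1 zr2
    !(mul0r, mulr0, subr0, sub0r) => h1 h2 h3.
  by constructor 1; split=> //; rewrite zp1.
- move=> [/eqP zp1 zp2 /eqP zp3 /eqP zq1 /eqP zq2 zq3 zr1 /eqP zr2 /eqP zr3].
  move: A2 B3 C1; rewrite zp1 zp3 zq1 zq2 zr2 zr3
    !(mul0r, mulr0, subr0, sub0r) => h1 h2 h3.
  by constructor 2; split=> //; rewrite zp2.
- move=> [/eqP zp1 /eqP zp2 zp3 zq1 /eqP zq2 /eqP zq3 /eqP zr1 zr2 /eqP zr3].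
  move: A3 B1 C2; rewrite zp1 zp2 zq2 zq3 zr1 zr3
    !(mul0r, mulr0, subr0, sub0r) => h1 h2 h3.
  by constructor 3; split=> //; rewrite zp3.
- move=> [zp1 /eqP zp2 /eqP zp3 /eqP zq1 /eqP zq2 zq3 /eqP zr1 zr2 /eqP zr3].
  move: A1 B3 C2; rewrite zp2 zp3 zq1 zq2 zr1 zr3
    !(mul0r, mulr0, subr0, sub0r) => h1 h2 h3.
  by case: (@odd_pattern_absurd p1 q3 r2 n2); rewrite ?zp1 // (h1, h2, h3) mulrC.
- move=> [/eqP zp1 zp2 /eqP zp3 zq1 /eqP zq2 /eqP zq3 /eqP zr1 /eqP zr2 zr3].
  move: A2 B1 C3; rewrite zp1 zp3 zq2 zq3 zr1 zr2
    !(mul0r, mulr0, subr0, sub0r) => h1 h2 h3.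
  by case: (@odd_pattern_absurd p2 q1 r3 n2); rewrite ?zp2 // (h1, h2, h3) mulrC.
- move=> [/eqP zp1 /eqP zp2 zp3 /eqP zq1 zq2 /eqP zq3 zr1 /eqP zr2 /eqP zr3].
  move: A3 B2 C1; rewrite zp1 zp2 zq1 zq3 zr2 zr3
    !(mul0r, mulr0, subr0, sub0r) => h1 h2 h3.
  by case: (@odd_pattern_absurd p3 q2 r1 n2); rewrite ?zp3 // (h1, h2, h3) mulrC.
Qed.

End Matrix.

Section Linear.
Variables (K : fieldType) (alpha : K).
Hypotheses (charK : [pchar K] =i pred0) (alpha3 : alpha ^+ 3 != 1).
Notation P := {mpoly K[3]}.
Implicit Types (u v w f g h : P).
Notation q := (qgrad alpha%:MP_[3]).

Lemma affine_form f : (msize f <= 2)%N ->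
  exists c a0 a1 a2, f = c%:MP + a0 *: varx + a1 *: vary + a2 *: varz.
Proof.
move=> f2; exists f@_0, f@_U_(0), f@_U_(1), f@_U_(2).
have const (p : P) : (msize p <= 1)%N -> p = (p@_0)%:MP by exact: msize1_polyC.
have df (i : 'I_3) : f^`M(i) = (f@_U_(i))%:MP.
  rewrite (const _ (msize_mderiv i f2)) mcoeff_deriv add0m mnm0E.
  by rewrite mulr1n.
have form0 (p : P) : pihomog mdeg 0 p = (p@_0)%:MP.
  apply/mpolyP => m; rewrite mcoeff_form mcoeffC mdeg_eq0.
  by case: eqP => [->|_]; rewrite ?mul1r ?mulr1 // mul0r mulr0.
have homC (c : K) : pihomog mdeg 0 c%:MP_[3] = c%:MP.
  by rewrite form0 mcoeffC eqxx mulr1.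
have dform1 (i : 'I_3) : (pihomog mdeg 1 f)^`M(i) = (f@_U_(i))%:MP.
  by rewrite -form_mderiv df homC.
have form1 := euler_homog (pihomogP mdeg 1 f).
rewrite sum_ord3 !dform1 mulr1n mul1r in form1.
have fE := pihomog_partitionE f2.
rewrite !big_ord_recl big_ord0 addr0 /= form0 -form1 in fE.
rewrite [LHS]fE {fE form1 dform1 df}.
move: (f@_0) (f@_U_(0)) (f@_U_(1)) (f@_U_(2)) => c a0 a1 a2.
by rewrite -!mul_mpolyC /varx /vary /varz; ring.
Qed.

(** The bracket relations are identities between quadratic polynomials; their
    values at all points carry the same information as their coefficients and
    are simpler to compute. *)
Lemma poisson_triple_linear f g h :
    poisson_triple alpha f g h -> f != 0 ->
    (msize f <= 2)%N -> (msize g <= 2)%N -> (msize h <= 2)%N ->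
  exists a b c, [/\ cyclic_rel a b c, a != 0 &
    [\/ [/\ f = a *: varx, g = b *: vary & h = c *: varz],
        [/\ f = c *: varz, g = a *: varx & h = b *: vary]
      | [/\ f = b *: vary, g = c *: varz & h = a *: varx]]].
Proof.
move=> [E1 E2 E3] f0 f2 g2 h2.
have [c1 [p1 [q1 [r1 fE]]]] := affine_form f2.
have [c2 [p2 [q2 [r2 gE]]]] := affine_form g2.
have [c3 [p3 [q3 [r3 hE]]]] := affine_form h2.
have n2 := natr_neq0 charK 1.
have der (c s t r : K) (p := c%:MP + s *: varx + t *: vary + r *: varz : P) :
    [/\ p^`M(0) = s%:MP, p^`M(1) = t%:MP & p^`M(2) = r%:MP].
  rewrite /p /varx /vary /varz !mderivD !mderivZ !mderivC !mderivXU -!mul_mpolyC.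
  by split; rewrite /=; ring.
have [f_0 f_1 f_2] := der c1 p1 q1 r1; rewrite -fE in f_0 f_1 f_2.
have [g_0 g_1 g_2] := der c2 p2 q2 r2; rewrite -gE in g_0 g_1 g_2.
have [h_0 h_1 h_2] := der c3 p3 q3 r3; rewrite -hE in h_0 h_1 h_2.
pose pt (x y z : K) : 'I_3 -> K := fun i => [:: x; y; z]`_i.
have ev (c s t r x y z : K) : (c%:MP + s *: varx + t *: vary + r *: varz).@[pt x y z]
    = c + s * x + t * y + r * z.
  by rewrite !mevalD !mevalZ mevalC !mevalXU.
have evq (u v w : P) (x y z : K) : (q u v w).@[pt x y z] =
    qgrad alpha u.@[pt x y z] v.@[pt x y z] w.@[pt x y z].
  by rewrite /qgrad !expr2 mevalB !mevalM mevalC.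
have evN (x y z : K) : [/\ (varx : P).@[pt x y z] = x, (vary : P).@[pt x y z] = y
    & (varz : P).@[pt x y z] = z] by split; rewrite mevalXU.
have coef (u1 u2 u3 v1 v2 v3 : K) (u v : P) (x y z : K):
    [/\ u^`M(0) = u1%:MP, u^`M(1) = u2%:MP & u^`M(2) = u3%:MP] ->
    [/\ v^`M(0) = v1%:MP, v^`M(1) = v2%:MP & v^`M(2) = v3%:MP] ->
    (elliptic_bracket alpha u v).@[pt x y z] =
    (u2 * v3 - v2 * u3) * qgrad alpha x y z
    + (u3 * v1 - v3 * u1) * qgrad alpha y z x + (u1 * v2 - v1 * u2) * qgrad alpha z x y.
  move=> [eu0 eu1 eu2] [ev0 ev1 ev2]; have [ex ey ez] := evN x y z.
  rewrite elliptic_bracketE // eu0 eu1 eu2 ev0 ev1 ev2.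
  have := evq varx vary varz x y z; have := evq vary varz varx x y z.
  have := evq varz varx vary x y z; rewrite ex ey ez.
  move: (q varx vary varz) (q vary varz varx) (q varz varx vary) => m1 m2 m3 e3 e2 e1.
  rewrite !mevalD !mevalM !mevalB !mevalM !mevalC e1 e2 e3.
  by congr (_ * _ + _ * _ + _ * _); ring.
have [] := @qgrad_linear_coef K alpha c1 c2 c3 p1 p2 p3 q1 q2 q3 r1 r2 r3 n2 _.
  move=> x y z; rewrite -!ev -fE -gE -hE -evq -E1.
  exact: coef.
move=> o1 L1.
have [] := @qgrad_linear_coef K alpha c2 c3 c1 p2 p3 p1 q2 q3 q1 r2 r3 r1 n2 _.
  move=> x y z; rewrite -!ev -fE -gE -hE -evq -E2.
  exact: coef.
move=> o2 L2.
have [] := @qgrad_linear_coef K alpha c3 c1 c2 p3 p1 p2 q3 q1 q2 r3 r1 r2 n2 _.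
  move=> x y z; rewrite -!ev -fE -gE -hE -evq -E3.
  exact: coef.
move=> o3 L3.
have [z1 z2 z3] := qgrad_eq0 alpha3 o1 o2 o3.
have row1 : ~~ [&& p1 == 0, q1 == 0 & r1 == 0].
  apply: contra f0 => /and3P[/eqP p10 /eqP q10 /eqP r10].
  by rewrite fE z1 p10 q10 r10 !scale0r mpolyC0 !addr0.
have sol := linear_triple alpha3 n2 row1 (L1 z1 z2 z3) (L2 z2 z3 z1) (L3 z3 z1 z2).
rewrite fE gE hE z1 z2 z3 mpolyC0 !add0r.
case: sol => [[rel nz [-> -> -> -> [-> ->]]]|[rel nz [-> -> -> -> [-> ->]]]
  |[rel nz [-> -> -> -> [-> ->]]]]; rewrite !scale0r !(addr0, add0r).
- by exists p1, q2, r3; split=> //; constructor 1.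
- by exists p2, q3, r1; split=> //; constructor 2.
- by exists p3, q1, r2; split=> //; constructor 3.
Qed.
End Linear.

(** * The generated group *)

(** Pointwise equality is absorbed by inverting twice. *)
Lemma generated_ext (T : Type) (S : (T -> T) -> Prop) (f g : T -> T) :
  generated S g -> bijective f -> f =1 g -> generated S f.
Proof.
move=> gen_g [h fK hK] fg.
have gen_h : generated S h.
  by apply: (Generated_inv gen_g) => t; rewrite -fg.
exact: (Generated_inv gen_h).
Qed.

Section Generators.
Variables (K : fieldType) (alpha : K).
Hypothesis charK : [pchar K] =i pred0.
Notation P := {mpoly K[3]}.
Implicit Types (u v f g h : P).

Lemma subst_comp f g h f' g' h' :
  subst f g h \o subst f' g' h' =1
  subst (subst f g h f') (subst f g h g') (subst f g h h').
Proof.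
apply: mpoly_rmorph_eq => [c|i] /=; first by rewrite !substC.
have [eX eY eZ] := subst_var f' g' h'.
have [eX' eY' eZ'] := subst_var (subst f g h f') (subst f g h g') (subst f g h h').
by case: (ord3P i) => ->; [rewrite eX eX'|rewrite eY eY'|rewrite eZ eZ'].
Qed.

Lemma bracket_var :
  poisson_triple alpha (varx : P) vary varz.
Proof.
by split; rewrite elliptic_bracketE // /varx /vary /varz !mderivXU /=; ring.
Qed.

Lemma bracketZ (a b : K) u v :
  elliptic_bracket alpha (a *: u) (b *: v) = (a * b) *: elliptic_bracket alpha u v.
Proof.
rewrite /elliptic_bracket !jacobianE !mderivZ -!mul_mpolyC rmorphM /=; ring.
Qed.

Lemma diag_triple a b c : cyclic_rel a b c ->
  poisson_triple alpha (a *: varx) (b *: vary) (c *: varz).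
Proof.
move=> [ra rb rc]; have [eX eY eZ] := bracket_var.
have qZ (s t r : K) u v w : s ^+ 2 = t * r -> (t * r) *: qgrad alpha%:MP u v w =
    qgrad alpha%:MP (s *: u) (t *: v) (r *: w).
  move=> e; rewrite /qgrad -!mul_mpolyC exprMn -rmorphXn e rmorphM /=; ring.
by split; rewrite bracketZ ?eX ?eY ?eZ; apply: qZ.
Qed.

Lemma cyclic_rel_neq0 (a b c : K) : cyclic_rel a b c -> a != 0 -> b != 0 /\ c != 0.
Proof.
move=> [ra _ _] a0; apply/andP; rewrite -negb_or -mulf_eq0 -ra.
by rewrite expf_eq0.
Qed.

Lemma diag_poisson_aut a b c : cyclic_rel a b c -> a != 0 ->
  poisson_aut (elliptic_bracket alpha) (subst (a *: varx) (b *: vary) (c *: varz)).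
Proof.
move=> rel a0; have [b0 c0] := cyclic_rel_neq0 rel a0.
apply: (@subst_poisson _ _ _ _ _ _ (a^-1 *: varx) (b^-1 *: vary) (c^-1 *: varz)) => //.
- exact: diag_triple.
- have [eX eY eZ] := subst_var (a *: varx) (b *: vary) (c *: varz).
  by split; rewrite linearZ /= ?eX ?eY ?eZ scalerA mulVf // scale1r.
have [eX eY eZ] := subst_var (a^-1 *: varx) (b^-1 *: vary) (c^-1 *: varz).
by split; rewrite linearZ /= ?eX ?eY ?eZ scalerA mulfV // scale1r.
Qed.

Lemma tau_poisson_aut : poisson_aut (elliptic_bracket alpha) tau.
Proof.
have [eX eY eZ] := bracket_var.
have [tX tY tZ] := subst_var (vary : P) varz varx.
have [uX uY uZ] := subst_var (varz : P) varx vary.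
exact: (@subst_poisson _ _ _ vary varz varx varz varx vary).
Qed.

Variables (eps : K) (heps : eps ^+ 2 + eps + 1 = 0).

Lemma eps3 : eps ^+ 3 = 1.
Proof.
apply/eqP; rewrite -subr_eq0; apply/eqP.
by transitivity ((eps - 1) * (eps ^+ 2 + eps + 1)); [ring | rewrite heps mulr0].
Qed.

Lemma generated_poisson_aut (phi : P -> P) :
  generated (elliptic_gens eps) phi -> poisson_aut (elliptic_bracket alpha) phi.
Proof.
elim=> {phi} [phi [c c0 | | ]| |f g _ fP _ gP|f g _ fP fK gK].
- by apply: diag_poisson_aut => //; split; rewrite expr2.
- have := @diag_poisson_aut 1 eps (eps ^+ 2) _ (oner_neq0 _); rewrite scale1r; apply.
  split; first by rewrite -exprS eps3 expr1n.
    by rewrite mulr1.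
  by rewrite -exprM exprSr eps3.
- exact: tau_poisson_aut.
- exact: poisson_aut_id.
- exact: poisson_aut_comp.
- exact: poisson_aut_inv fP fK gK.
Qed.

(** The ratio [t = b / a] satisfies [t ^+ 3 = 1], so it is one of [1, eps,
    eps ^+ 2], and [c / a = t ^+ 2]: the diagonal substitution is a homothety
    composed with a power of [sigma]. *)
Lemma diag_generated a b c : cyclic_rel a b c -> a != 0 ->
  exists2 psi : P -> P, generated (elliptic_gens eps) psi &
    psi =1 subst (a *: varx) (b *: vary) (c *: varz).
Proof.
move=> rel a0; have [b0 c0] := cyclic_rel_neq0 rel a0; have [ra rb rc] := rel.
pose t := b / a.
have bE : b = t * a by rewrite /t mulfVK.
have t3 : t ^+ 3 = 1.
  apply: (mulIf (expf_neq0 3 a0)); rewrite -exprMn -bE mul1r.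
  by rewrite exprS rb exprS ra; ring.
have cE : c = t ^+ 2 * a.
  apply: (mulfI b0); rewrite -ra bE -[LHS]mul1r -t3; ring.
have gen_phi := Generated_gen (Gen_phi eps a0).
have gen_sigma := Generated_gen (Gen_sigma eps).
have [sX sY sZ] := subst_var (a *: varx : P) (a *: vary) (a *: varz).
have [eX eY eZ] := subst_var (varx : P) (eps *: vary) (eps ^+ 2 *: varz).
have : (t - 1) * (t - eps) * (t - eps ^+ 2) == 0.
  apply/eqP; transitivity ((t ^+ 3 - eps ^+ 3)
    - (eps ^+ 2 + eps + 1) * (t ^+ 2 - eps * t)); first by ring.
  by rewrite heps t3 eps3 mul0r !subrr.
rewrite !mulf_eq0 !subr_eq0 -orbA => /or3P[] /eqP tE; rewrite bE cE tE.
- by exists (phi_scale a) => //; rewrite expr1n !mul1r.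
- exists (phi_scale a \o sigma eps); first exact: Generated_comp.
  move=> p; rewrite [LHS]subst_comp !linearZ /= sX sY sZ !scalerA.
  by [].
- exists (phi_scale a \o (sigma eps \o sigma eps)).
    by apply: (Generated_comp) => //; apply: Generated_comp.
  have e4 : eps ^+ 2 * eps ^+ 2 = eps by rewrite -exprD [LHS]exprSr eps3 mul1r.
  move=> p; have ss : (sigma eps \o sigma eps) p =
      subst varx (eps ^+ 2 *: vary) (eps *: varz) p.
    by rewrite [LHS]subst_comp !linearZ /= eX eY eZ !scalerA -expr2 e4.
  rewrite [LHS]/= [X in phi_scale _ X]ss [LHS]subst_comp !linearZ /= sX sY sZ !scalerA.
  by rewrite [(eps ^+ 2) ^+ 2]expr2 e4.
Qed.

End Generators.

Theorem theorem1 (K : fieldType) (charK : [pchar K] =i pred0)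
    (eps : K) (heps : eps ^+ 2 + eps + 1 = 0)
    (alpha : K) (halpha : alpha ^+ 3 != 1) (phi : {mpoly K[3]} -> {mpoly K[3]}) :
  poisson_aut (elliptic_bracket alpha) phi <->
  generated (elliptic_gens eps) phi.
Proof.
split=> [phi_aut | ]; last exact: generated_poisson_aut.
have [f [g [h [f' [g' [h' [phiE fgh sK]]]]]]] := poisson_aut_subst charK phi_aut.
have Junit := jacobian_unit sK.
have f0 : f != 0.
  apply: contraTneq Junit => ->.
  by rewrite jacobianE !mderiv0 !mul0r subrr addr0 unitr0.
have [f2 g2 h2] := poisson_triple_msize charK halpha fgh Junit.
have [a [b [c [rel a0 shape]]]] := poisson_triple_linear charK halpha fgh f0 f2 g2 h2.
have [psi psi_gen psiE] := diag_generated heps rel a0.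
have gen_tau := Generated_gen (Gen_tau eps).
have [phi_bij _ _ _] := phi_aut.
have [sX sY sZ] := subst_var (a *: varx) (b *: vary) (c *: varz).
have [tX tY tZ] := subst_var (vary : {mpoly K[3]}) varz varx.
case: shape => -[fE gE hE].
- by apply: (generated_ext psi_gen) => // p; rewrite phiE psiE fE gE hE.
- have gen2 := Generated_comp psi_gen (Generated_comp gen_tau gen_tau).
  apply: (generated_ext gen2) => // p; rewrite phiE [RHS]/= psiE.
  have -> : tau (tau p) = subst varz varx vary p.
    by rewrite [LHS]subst_comp tX tY tZ.
  by rewrite [RHS]subst_comp sX sY sZ fE gE hE.
- apply: (generated_ext (Generated_comp psi_gen gen_tau)) => // p.
  by rewrite phiE [RHS]/= psiE [RHS]subst_comp sX sY sZ fE gE hE.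
Qed.
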